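(* Let $H$ be a (real or complex) Hilbert space of dimension not less than $3$ and let $\eta\in B(H)$ be invertible. Suppose that $T:\underline{H}\to\underline{H}$ is a bijective transformation with the property that $$T\underline{x}\cdot_\eta T\underline{y}=0\quad\text{if and only if}\quad \underline{x}\cdot_\eta\underline{y}=0$$ holds for every $\underline{x},\underline{y}\in\underline{H}$. (1) If $H$ is real, then $T$ is induced by an invertible bounded linear operator $U$ on $H$. If $H$ is complex, then $T$ is induced by an invertible bounded linear or conjugate-linear operator $U$ on $H$. (2) The operator $U$ inducing $T$ is unique up to multiplication by a scalar. (3) If $H$ is real, then an invertible bounded linear operator $U:H\to H$ induces a symmetry transformation on $\underline{H}$ if and only if $$(Ux,Uy)_\eta=c\,(x,y)_\eta\qquad (x,y\in H)$$ holds for some constant $c\in\mathbb{R}$. (4) If $H$ is complex, then an invertible bounded linear operator $U:H\to H$ induces a symmetry transformation on $\underline{H}$ if and only if $$(Ux,Uy)_\eta=c\,(x,y)_\eta\qquad (x,y\in H)$$ holds for some constant $c\in\mathbb{C}$. Similarly, if $H$ is complex, an invertible bounded conjugate-linear operator $U:H\to H$ induces a symmetry transformation on $\underline{H}$ if and only if $$(Ux,Uy)_\eta=d\,(y,x)_{\eta^*}\qquad (x,y\in H)$$ holds for some constant $d\in\mathbb{C}$, where $\eta^*$ denotes the Hilbert space adjoint of $\eta$.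
   Context: $B(H)$ denotes the algebra of all bounded linear operators on the Hilbert space $H$, whose inner product $\langle\cdot,\cdot\rangle$ is linear in the first variable. For a vector $x\in H$, the set $\underline{x}$ of all nonzero scalar multiples of $x$ is called the ray generated by $x$; $\underline{H}$ denotes the set of all rays in $H$. For an invertible $\eta\in B(H)$ (not necessarily self-adjoint), put $(x,y)_\eta=\langle\eta x,y\rangle$ for $x,y\in H$ (and similarly $(x,y)_{\eta^*}=\langle\eta^*x,y\rangle$). Write $\underline{x}\cdot_\eta\underline{y}=0$ if $\langle\eta x_0,y_0\rangle=0$ for every $x_0\in\underline{x}$ and $y_0\in\underline{y}$. A transformation $T:\underline{H}\to\underline{H}$ is called a symmetry transformation (on the indefinite inner product space generated by $\eta$) if $T\underline{x}\cdot_\eta T\underline{y}=0\Longleftrightarrow\underline{x}\cdot_\eta\underline{y}=0$ for all $\underline{x},\underline{y}\in\underline{H}$. A transformation $T:\underline{H}\to\underline{H}$ is said to be induced by the invertible linear or conjugate-linear operator $U:H\to H$ if $T\underline{x}=\underline{Ux}$ for every $0\neq x\in H$. *)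

(* Defs.v *)
(* Based on MathComp and MathComp-Analysis. *)
From HB Require Import structures.
From mathcomp Require Import all_boot all_order all_algebra.
From mathcomp Require Export sesquilinear complex.
From mathcomp Require Import boolp classical_sets reals topology normedtype.

Set Implicit Arguments.
Unset Strict Implicit.
Unset Printing Implicit Defensive.

Import GRing.Theory Num.Theory.
Import numFieldNormedType.Exports.

Local Open Scope classical_set_scope.
Local Open Scope ring_scope.

Definition dim_ge (n : nat) (K : numFieldType) (H : lmodType K) : Prop :=
  exists v : 'I_n -> H,
    forall a : 'I_n -> K, \sum_(i < n) a i *: v i = 0 -> forall i, a i = 0.

(* A Hilbert space over K is a complete normed K-module whose norm comes from
   an inner product dot, linear in the first variable and theta-semilinear in
   the second: theta is idfun for K = R and Num.conj for K = R[i]. *)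
Definition norm_from_dot (K : numFieldType) (theta : K -> K)
    (H : completeNormedModType K) (dot : {dot H for theta}) : Prop :=
  forall x : H, `|x| ^+ 2 = dot x x.

Definition bounded_op (K : numFieldType) (H : normedModType K)
    (U : H -> H) : Prop :=
  exists M : K, forall x : H, `|U x| <= M * `|x|.

(* For a linear or conjugate-linear U, this says that U is bounded and has a
   bounded two-sided inverse (which is then of the same kind); for a linear U,
   it is invertibility in B(H). *)
Definition invertible_bounded (K : numFieldType) (H : normedModType K)
    (U : H -> H) : Prop :=
  bounded_op U /\
  exists V : H -> H, [/\ bounded_op V, cancel U V & cancel V U].

Definition conj_linear (C : numClosedFieldType) (H : lmodType C)
    (U : H -> H) : Prop :=
  GRing.linear_for (Num.conj \; *:%R) U.

(* The value at y is the unique z with <A x, y> = <x, z> for all x; for a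
   bounded linear A it exists by the Riesz representation theorem. *)
Definition adjoint (K : numFieldType) (theta : K -> K)
    (H : completeNormedModType K) (dot : {dot H for theta})
    (A : H -> H) (y : H) : H :=
  xget 0 [set z : H | forall x : H, dot (A x) y = dot x z].

Definition eta_form (K : numFieldType) (theta : K -> K)
    (H : completeNormedModType K) (dot : {dot H for theta})
    (eta : H -> H) (x y : H) : K := dot (eta x) y.

Definition ray (K : numFieldType) (H : lmodType K) (x : H) : set H :=
  [set y : H | exists2 c : K, c != 0 & y = c *: x].

(* Every vector generates a ray; the zero vector generates the degenerate ray
   [set 0]. *)
Definition rays (K : numFieldType) (H : lmodType K) : Type :=
  {r : set H | exists x : H, r = ray x}.

Definition ray_of (K : numFieldType) (H : lmodType K) (x : H) : rays H :=
  exist _ (ray x) (ex_intro _ x erefl).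

Definition ray_orth (K : numFieldType) (theta : K -> K)
    (H : completeNormedModType K) (dot : {dot H for theta})
    (eta : H -> H) (r s : rays H) : Prop :=
  forall x0 y0 : H, sval r x0 -> sval s y0 -> eta_form dot eta x0 y0 = 0.

Definition symmetry_transformation (K : numFieldType) (theta : K -> K)
    (H : completeNormedModType K) (dot : {dot H for theta})
    (eta : H -> H) (T : rays H -> rays H) : Prop :=
  forall r s : rays H,
    ray_orth dot eta (T r) (T s) <-> ray_orth dot eta r s.

Definition induced_by (K : numFieldType) (H : lmodType K)
    (T : rays H -> rays H) (U : H -> H) : Prop :=
  forall x : H, x != 0 -> T (ray_of x) = ray_of (U x).

Definition induces_symmetry (K : numFieldType) (theta : K -> K)
    (H : completeNormedModType K) (dot : {dot H for theta})
    (eta U : H -> H) : Prop :=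
  exists2 T : rays H -> rays H,
    symmetry_transformation dot eta T & induced_by T U.

(* Main.v *)
(* A symmetry preserves the relation "B x y = 0" in both directions, where
   B x y = <eta x, y>. Since eta is onto, a vector lies in the span of y and z
   iff it is B-orthogonal to everything that is B-orthogonal to y and z, so T
   preserves lines of the projective space of H and is induced by a bijective
   sigma-semilinear map U. Comparing the kernels of x |-> B (U x) (U y) and
   x |-> B x y gives B (U x) (U y) = c * sigma (B x y) with one constant c;
   comparing the two sides at a scalar multiple of y, sigma commutes with the
   conjugation, so it preserves the reals, where it is the identity: sigma is
   the identity or the conjugation. Finally the formula for B (U x) (U y) makes
   the image under eta o U of the unit sphere weakly bounded, and U is bounded
   by the uniform boundedness principle. *)

Require Import Defs.
From HB Require Import structures.
From mathcomp Require Import all_boot all_order all_algebra.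
From mathcomp Require Import boolp classical_sets reals topology normedtype.
From mathcomp Require Import ring.

Set Implicit Arguments.
Unset Strict Implicit.
Unset Printing Implicit Defensive.

Import Order.TTheory GRing.Theory Num.Theory.
Import numFieldNormedType.Exports.

Local Open Scope classical_set_scope.
Local Open Scope complex_scope.
Local Open Scope ring_scope.

(** * The fundamental theorem of projective geometry *)

Section Independence.
Variables (K : fieldType) (H : lmodType K).
Implicit Types x y z : H.

(** The two generators may coincide: [span2 x x y] says that [y] is a multiple of [x]. *)
Definition span2 y z x : Prop := exists a b : K, x = a *: y + b *: z.

Definition indep2 x y : Prop :=
  forall a b : K, a *: x + b *: y = 0 -> a = 0 /\ b = 0.

Definition indep3 x y z : Prop :=
  forall a b c : K, a *: x + b *: y + c *: z = 0 -> [/\ a = 0, b = 0 & c = 0].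

Lemma span2l x y : span2 x y x.
Proof. by exists 1, 0; rewrite scale1r scale0r addr0. Qed.

Lemma span2r x y : span2 x y y.
Proof. by exists 0, 1; rewrite scale1r scale0r add0r. Qed.

Lemma span2D x y : span2 x y (x + y).
Proof. by exists 1, 1; rewrite !scale1r. Qed.

Lemma indep2C x y : indep2 x y -> indep2 y x.
Proof. by move=> i a b; rewrite addrC => /i[]. Qed.

Lemma indep3C x y z : indep3 x y z -> indep3 y x z.
Proof. by move=> i a b c; rewrite [X in X + _]addrC => /i[]. Qed.

Lemma indep3CA x y z : indep3 x y z -> indep3 x z y.
Proof. by move=> i a b c; rewrite addrAC => /i[]. Qed.

Lemma indep3_indep2 x y z : indep3 x y z -> indep2 x y.
Proof.
by move=> i a b e; have [] := i a b 0; rewrite ?scale0r ?addr0.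
Qed.

Lemma indep2_neq0 x y : indep2 x y -> x != 0.
Proof.
move=> i; apply/eqP => x0; have [] := i 1 0.
  by rewrite x0 scaler0 scale0r addr0.
by move/eqP; rewrite oner_eq0.
Qed.

Lemma indep2Z (c : K) x y : c != 0 -> indep2 x y -> indep2 (c *: x) y.
Proof.
move=> c0 i a b; rewrite scalerA => /i[/eqP]; rewrite mulf_eq0 (negPf c0) orbF.
by move/eqP.
Qed.

Lemma indep2D x y : indep2 x y -> indep2 x (x + y).
Proof.
move=> i a b; rewrite scalerDr addrA -scalerDl => /i[ab0 b0].
by split=> //; move: ab0; rewrite b0 addr0.
Qed.

Lemma indep3D x y z : indep3 x y z -> indep2 (x + y) z.
Proof. by move=> i a b; rewrite scalerDr => /i[]. Qed.

Lemma not_indep2 x y : x != 0 -> ~ indep2 x y -> exists a, y = a *: x.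
Proof.
move=> x0 /existsNP[a /existsNP[b /not_implyP[e ab]]].
have b0 : b != 0.
  apply/eqP => b0; apply: ab; split=> //; apply/eqP; move/eqP: e.
  by rewrite b0 scale0r addr0 scaler_eq0 (negPf x0) orbF.
exists (- (b^-1 * a)); rewrite scaleNr -scalerA.
by move/eqP: e; rewrite addr_eq0 => /eqP->; rewrite scalerN opprK scalerK.
Qed.

Lemma indep2_span x y : indep2 x y -> ~ span2 x x y.
Proof.
move=> i [a [b e]]; have [] := i (a + b) (-1).
  by rewrite scalerDl -e scaleN1r subrr.
by move=> _ /eqP; rewrite oppr_eq0 oner_eq0.
Qed.

Lemma nspan_indep2 x y : x != 0 -> ~ span2 x x y -> indep2 x y.
Proof.
move=> x0 n; apply: contrapT => /(not_indep2 x0)[a e]; apply: n.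
by exists a, 0; rewrite scale0r addr0.
Qed.

Lemma indep3_span x y z : indep3 x y z -> ~ span2 x y z.
Proof.
move=> i [a [b e]]; have [] := i a b (-1).
  by rewrite -e scaleN1r subrr.
by move=> _ _ /eqP; rewrite oppr_eq0 oner_eq0.
Qed.

Lemma nspan_indep3 x y z : indep2 x y -> ~ span2 x y z -> indep3 x y z.
Proof.
move=> i n a b c e; have [c0|c0] := eqVneq c 0.
  by move: e; rewrite c0 scale0r addr0 => /i[-> ->].
case: n; exists (- (c^-1 * a)), (- (c^-1 * b)).
move/eqP: e; rewrite addrC addr_eq0 => /eqP e.
apply: (scalerI c0); rewrite e scalerDr !scalerA !mulrN !mulrA mulfV// !mul1r.
by rewrite !scaleNr opprD.
Qed.

Lemma span2_trans y z u v x :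
  span2 y z u -> span2 y z v -> span2 u v x -> span2 y z x.
Proof.
move=> [a [b ->]] [c [d ->]] [p [q ->]].
exists (p * a + q * c), (p * b + q * d).
by rewrite !scalerDr !scalerA addrACA !scalerDl.
Qed.

Lemma indep3Z (c : K) x y z : c != 0 -> indep3 x y z -> indep3 (c *: x) y z.
Proof.
move=> c0 i a b d; rewrite scalerA => /i[/eqP]; rewrite mulf_eq0 (negPf c0) orbF.
by move/eqP.
Qed.

Lemma indep3_inj x y z (a b c a' b' c' : K) : indep3 x y z ->
  a *: x + b *: y + c *: z = a' *: x + b' *: y + c' *: z ->
  [/\ a = a', b = b' & c = c'].
Proof.
move=> i e; have [] := i (a - a') (b - b') (c - c').
  by rewrite !scalerBl [X in X + _]addrACA -opprD addrACA -opprD e subrr.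
by move=> /subr0_eq-> /subr0_eq-> /subr0_eq->.
Qed.

End Independence.

(** If all three [v i] lay in the span, their coefficients would form a 3 by 2 matrix of rank at
    most 2, and a nonzero row of its left kernel would be a linear relation between the [v i]. *)
Lemma dim_ge3_span2 (K : numFieldType) (H : lmodType K) (y z : H) :
  dim_ge 3 H -> exists x, ~ span2 y z x.
Proof.
move=> [v iv]; apply: contrapT => /forallNP all_in.
have /choice[f fE] : forall i, exists p : K * K, v i = p.1 *: y + p.2 *: z.
  by move=> i; have /contrapT[a [b e]] := all_in (v i); exists (a, b).
pose A : 'M[K]_(3, 2) := \matrix_(i, j) (if j == 0 then (f i).1 else (f i).2).
have kA : kermx A != 0.
  rewrite kermx_eq0 /row_free; apply: contraL (rank_leq_col A) => /eqP->.
  by [].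
have [i ki] : exists i, row i (kermx A) != 0.
  apply: contrapT => /forallNP h; move/eqP: kA; apply.
  by apply/row_matrixP => i; rewrite row0; apply/eqP/negPn/negP/h.
set u := row i (kermx A) in ki *.
have uA : u *m A = 0 by apply/sub_kermxP; rewrite row_sub.
have uAj j : \sum_i u 0 i * A i j = 0.
  by move/matrixP/(_ 0 j): uA; rewrite !mxE.
case/eqP: ki; apply/rowP => j; rewrite [RHS]mxE.
apply: (iv (fun i => u 0 i)).
under eq_bigr do rewrite fE scalerDr !scalerA.
rewrite big_split /= -!scaler_suml.
have A0 m : A m 0 = (f m).1 by rewrite mxE.
have A1 m : A m 1 = (f m).2 by rewrite mxE.
have := uAj 0; under eq_bigr do rewrite A0.
move=> ->; have := uAj 1; under eq_bigr do rewrite A1.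
by move=> ->; rewrite !scale0r addr0.
Qed.

(** * Semilinear maps from span-preserving maps *)

Section FundamentalTheorem.
Variables (K : fieldType) (H : lmodType K).
Hypothesis dim3 : forall y z : H, exists x, ~ span2 y z x.
Variable g : H -> H.
Hypothesis g0 : g 0 = 0.
Hypothesis g_span : forall x y z, span2 (g y) (g z) (g x) <-> span2 y z x.

Lemma collineation_eq0 x : g x = 0 -> x = 0.
Proof.
move=> gx; have /g_span : span2 (g 0) (g 0) (g x) by rewrite g0 gx; exact: span2l.
by move=> [a [b ->]]; rewrite !scaler0 addr0.
Qed.

Lemma collineation_indep2 x y : indep2 x y -> indep2 (g x) (g y).
Proof.
move=> i; apply: nspan_indep2.
  by apply/eqP => /collineation_eq0/eqP; rewrite (negPf (indep2_neq0 i)).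
by move/g_span; exact: indep2_span.
Qed.

Lemma collineation_indep3 x y z : indep3 x y z -> indep3 (g x) (g y) (g z).
Proof.
move=> i; apply: nspan_indep3.
  exact/collineation_indep2/(indep3_indep2 i).
by move/g_span; exact: indep3_span.
Qed.

(* [k] is the ratio of the representatives of the images of [x] and [y] that a
   semilinear map inducing [g] would have to choose. *)
Lemma exists_ratio x y : exists k : K, indep2 x y ->
  k != 0 /\ exists2 c, c != 0 & g (x + y) = c *: (g x + k *: g y).
Proof.
have [i|] := pselect (indep2 x y); last by exists 0.
have /g_span[a [b e]] := span2D x y.
(* A vanishing coefficient [a] or [b] would put [g (x + y)] on the line of [g y] or [g x], hence
   [x + y] on the line of [y] or [x]. *)
have aux u v (c : K) : indep2 u v -> g (u + v) != c *: g v.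
  move=> iuv; apply/eqP => ec.
  have /g_span[p [q]] : span2 (g v) (g v) (g (u + v)).
    by exists c, 0; rewrite scale0r addr0.
  move=> euv; have [] := iuv 1 (1 - p - q).
    by rewrite !scalerBl !scale1r !addrA euv addrAC addrK subrr.
  by move/eqP; rewrite oner_eq0.
have a0 : a != 0.
  by apply: contra_neq (aux _ _ b i) => a0; rewrite e a0 scale0r add0r.
have b0 : b != 0.
  apply: contra_neq (aux _ _ a (indep2C i)) => b0.
  by rewrite addrC e b0 scale0r addr0.
exists (b / a) => _; split; first by rewrite mulf_neq0 ?invr_eq0.
by exists a => //; rewrite scalerDr scalerA mulrC divfK.
Qed.

(** The second property makes [r] a multiplicative cocycle, which [exists_potential] turns into
    quotients [s y / s x]. *)
Lemma exists_ratio_function : exists r : H -> H -> K,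
  (forall x y, indep2 x y ->
    r x y != 0 /\ exists2 c, c != 0 & g (x + y) = c *: (g x + r x y *: g y)) /\
  (forall x y z, indep3 x y z -> r x z = r x y * r y z).
Proof.
have /choice[r rP] := fun p => exists_ratio p.1 p.2.
exists (fun x y => r (x, y)); split=> [x y i|x y z i]; first exact: rP (x, y) i.
(* Compute [g (x + y + z)] in three ways and compare coefficients. *)
have [_ [c1 c10 e1]] := rP (x, y) (indep3_indep2 i).
have [_ [c2 c20 /= e2]] := rP (x + y, z) (indep3D i).
have iyz := indep3CA (indep3C i).
have [_ [d1 d10 /= f1]] := rP (y, z) (indep3_indep2 iyz).
have ixz := indep3CA i.
have [_ [h1 h10 /= k1]] := rP (x, z) (indep3_indep2 ixz).
have [_ [d2 d20 /= f2]] := rP (x, y + z) (indep2C (indep3D iyz)).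
have [_ [h2 h20 /= k2]] := rP (x + z, y) (indep3D ixz).
have ig := collineation_indep3 i.
have [eqa eqb eqc] : [/\ c2 * c1 = h2 * h1, c2 * (c1 * r (x, y)) =
    h2 * r (x + z, y) & c2 * r (x + y, z) = h2 * (h1 * r (x, z))].
  apply: (indep3_inj ig); rewrite -!scalerA [RHS]addrAC -!scalerDr.
  by rewrite -e1 -e2 -k1 -k2 addrAC.
have [fqa fqb fqc] : [/\ c2 * c1 = d2, c2 * (c1 * r (x, y)) =
    d2 * (r (x, y + z) * d1) & c2 * r (x + y, z) =
    d2 * (r (x, y + z) * (d1 * r (y, z)))].
  apply: (indep3_inj ig); rewrite -!scalerA -[RHS]addrA -!scalerDr.
  by rewrite -e1 -e2 -f1 -f2 addrA.
apply: (mulfI (mulf_neq0 h20 h10)); rewrite -mulrA -eqc fqc -eqa.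
by rewrite [RHS]mulrA -(mulrA c2) fqb !mulrA.
Qed.

(* [s x] has to be [r e x] for a base point [e]; when [x] is proportional to
   [e] one goes through an auxiliary vector [w] off the line. *)
Lemma exists_potential (r : H -> H -> K) :
    (forall x y, indep2 x y -> r x y != 0) ->
    (forall x y z, indep3 x y z -> r x z = r x y * r y z) ->
  exists s : H -> K, (forall x, x != 0 -> s x != 0) /\
    forall x y, indep2 x y -> s y = s x * r x y.
Proof.
move=> r0 rC; have [e eN] := dim3 0 0.
have e0 : e != 0 by apply/eqP => e0; apply: eN; rewrite e0; exact: span2l.
have indepl x w : ~ span2 e x w -> indep2 e w.
  move=> n; apply: nspan_indep2 => // h; apply: n.
  by apply: span2_trans h; exact: span2l.
have indepr x w : x != 0 -> ~ span2 e x w -> indep2 w x.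
  move=> x0 n; apply/indep2C/nspan_indep2 => // h; apply: n.
  by apply: span2_trans h; exact: span2r.
have direct x w : indep2 e x -> ~ span2 e x w -> r e x = r e w * r w x.
  by move=> i n; apply/rC/indep3CA/nspan_indep3.
have wd x w w' : x != 0 -> ~ span2 e x w -> ~ span2 e x w' ->
    r e w * r w x = r e w' * r w' x.
  move=> x0 nw nw'; have [iex|] := pselect (indep2 e x).
    by rewrite -!direct.
  move=> /(not_indep2 e0)[a xE]; have a0 : a != 0.
    by apply: contra_neq x0 => a0; rewrite xE a0 scale0r.
  (* Here [x] is on the line of [e], so the cocycle identity inserts [r u u'] on both sides: in
     [r e u'] and in [r u x]. *)
  have step u u' : indep3 e u u' -> r e u * r u x = r e u' * r u' x.
    move=> i; rewrite (rC e u u') // -mulrA -(rC u u' x) // xE.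
    by apply/indep3CA/indep3C/indep3CA; exact: (indep3Z a0 (indep3CA i)).
  have iw := indepl _ _ nw; have iw' := indepl _ _ nw'.
  have [sww'|] := pselect (span2 e w w'); last by move/(nspan_indep3 iw)/step.
  (* When [e], [w], [w'] are coplanar, compare both with a vector [v] off their common plane. *)
  have [v nv] := dim3 e w.
  rewrite (step w v); last exact: nspan_indep3.
  rewrite (step w' v) //; apply: nspan_indep3 => // h; apply: nv.
  by apply: span2_trans h => //; exact: span2l.
have /choice[s sP] : forall x, exists t, x != 0 -> forall w, ~ span2 e x w ->
    t = r e w * r w x.
  move=> x; have [w nw] := dim3 e x; exists (r e w * r w x) => x0 w' nw'.
  exact: wd.
exists s; split=> [x x0|x y i].
  have [w nw] := dim3 e x; rewrite (sP x x0 _ nw) mulf_neq0 ?r0//.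
    exact: indepl nw.
  exact: indepr nw.
have x0 := indep2_neq0 i; have y0 := indep2_neq0 (indep2C i).
(* If [e] is in the plane of [x] and [y], one [w] off that plane serves both values of [s];
   otherwise [s] is [r e] at both vectors. *)
have [sxy|/(nspan_indep3 i) i3] := pselect (span2 x y e).
  have [w nw] := dim3 x y.
  have nex : ~ span2 e x w.
    by move=> h; apply: nw; apply: span2_trans h => //; exact: span2l.
  have ney : ~ span2 e y w.
    by move=> h; apply: nw; apply: span2_trans h => //; exact: span2r.
  rewrite (sP x x0 _ nex) (sP y y0 _ ney) -mulrA -(rC w x y) //.
  exact/indep3C/indep3CA/(nspan_indep3 i).
have iexy := indep3C (indep3CA i3).
have sE z : z != 0 -> indep2 e z -> s z = r e z.
  by move=> z0 iz; have [w nw] := dim3 e z; rewrite (sP z z0 _ nw) -direct.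
rewrite !sE//; first exact: rC.
  exact: (indep3_indep2 iexy).
exact: (indep3_indep2 (indep3CA iexy)).
Qed.

(** For dependent [x] and [y], take [z] off their line, expand [U (x + y + z)] with both bracketings
    and cancel [U z]. *)
Lemma indep_additive (U : H -> H) : U 0 = 0 ->
  (forall x y, indep2 x y -> U (x + y) = U x + U y) -> {morph U : x y / x + y}.
Proof.
move=> U0 Ui x y.
have [->|x0] := eqVneq x 0; first by rewrite U0 !add0r.
have [i|/(not_indep2 x0)[a yE]] := pselect (indep2 x y); first exact: Ui.
have [->|y0] := eqVneq y 0; first by rewrite U0 !addr0.
have a0 : a != 0 by apply: contra_neq y0 => a0; rewrite yE a0 scale0r.
have [z /(nspan_indep2 x0) ixz] := dim3 x x.
have ixyz : indep2 x (y + z).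
  move=> b c; rewrite yE scalerDr addrA scalerA -scalerDl => /ixz[+ c0].
  by rewrite c0 mul0r addr0.
have : U (x + (y + z)) = U x + U y + U z.
  by rewrite Ui// Ui ?addrA// yE; exact: indep2Z.
rewrite addrA; have [->|xy0] := eqVneq (x + y) 0.
  by rewrite add0r U0 => e; apply: (@addIr _ (U z)); rewrite add0r.
rewrite (Ui (x + y) z); first by move=> e; exact: (@addIr _ (U z)).
have xyE : x + y = (1 + a) *: x by rewrite scalerDl scale1r -yE.
rewrite xyE in xy0 *; apply: indep2Z => //.
by apply: contra_neq xy0 => ->; rewrite scale0r.
Qed.

(** Rescaled by the potential, [g] becomes additive up to a factor on independent pairs; a third
    independent vector forces that factor to be 1. The scalar [t (a, x)] by which [U] responds to
    [a] then turns out not to depend on [x]. *)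
Theorem fundamental_theorem : exists (U : H -> H) (sigma : {rmorphism K -> K}),
  [/\ {morph U : x y / x + y}, forall a x, U (a *: x) = sigma a *: U x
    & forall x, exists2 c, c != 0 & U x = c *: g x].
Proof.
have [r [rP rC]] := exists_ratio_function.
have [s [s0 sr]] := exists_potential (fun x y i => (rP x y i).1) rC.
pose U x := s x *: g x.
have UE x : U x = s x *: g x by [].
have U0 : U 0 = 0 by rewrite UE g0 scaler0.
have Uneq0 x : x != 0 -> U x != 0.
  move=> x0; rewrite scaler_eq0 negb_or s0//=.
  by apply: contra_neq x0; exact: collineation_eq0.
have Ui x y : indep2 x y -> indep2 (U x) (U y).
  move=> i a b; rewrite !scalerA => /(collineation_indep2 i)[/eqP + /eqP].
  rewrite !mulf_eq0 (negPf (s0 _ (indep2_neq0 i))).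
  by rewrite (negPf (s0 _ (indep2_neq0 (indep2C i)))) !orbF => /eqP-> /eqP->.
have Ud x y : indep2 x y -> exists2 d, d != 0 & U (x + y) = d *: (U x + U y).
  move=> i; have [_ [c c0 e]] := rP x y i.
  have sx0 := s0 _ (indep2_neq0 i).
  have xy0 : x + y != 0.
    apply/eqP => xy0; have [] := i 1 1; rewrite ?scale1r//.
    by move/eqP; rewrite oner_eq0.
  (* Since [s y = s x * r x y], multiplying [g x + r x y *: g y] by [s x] gives [U x + U y]. *)
  exists (s (x + y) * c / s x).
    by rewrite !mulf_neq0 ?s0// invr_eq0.
  rewrite /U e scalerA (sr x y i) -[(s x * _) *: _]scalerA -scalerDr.
  by rewrite [RHS]scalerA divfK.
have Uadd : {morph U : x y / x + y}.
  apply: indep_additive => // x y i.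
  have [z /(nspan_indep3 i) i3] := dim3 x y.
  have [d d0 ed] := Ud x y i; rewrite ed.
  have iyz := indep3CA (indep3C i3).
  have [d1 d10 e1] := Ud (x + y) z (indep3D i3).
  have [d2 d20 e2] := Ud x (y + z) (indep2C (indep3D iyz)).
  have [d3 d30 e3] := Ud y z (indep3_indep2 iyz).
  have iU : indep3 (U x) (U y) (U z).
    move=> a b c; rewrite !scalerA => /(collineation_indep3 i3).
    have nz u v w : indep3 u v w -> s u != 0 by move/indep3_indep2/indep2_neq0/s0.
    have nx := nz _ _ _ i3; have ny := nz _ _ _ iyz.
    have nz' := nz _ _ _ (indep3C (indep3CA i3)).
    by case=> /eqP + /eqP + /eqP; rewrite !mulf_eq0 (negPf nx) (negPf ny)
      (negPf nz') !orbF => /eqP-> /eqP-> /eqP->.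
  (* Coefficients of [U x], [U y], [U z] in the two expansions of [U (x + y + z)]; the last two
     equations give [d1 * d = d1]. *)
  have [] : [/\ d1 * d = d2, d1 * d = d2 * d3 & d1 = d2 * d3].
    apply: (indep3_inj iU); rewrite -!scalerA -[RHS]addrA -!scalerDr.
    by rewrite -ed -e1 -e3 -e2 addrA.
  move=> _ e1' e2'; have d1E : d = 1.
    by apply: (mulfI d10); rewrite mulr1 e1' -e2'.
  by rewrite d1E scale1r.
have Uscale (p : K * H) : exists k, p.2 != 0 -> U (p.1 *: p.2) = k *: U p.2.
  have /g_span[b [c e]] : span2 p.2 p.2 (p.1 *: p.2).
    by exists p.1, 0; rewrite scale0r addr0.
  exists (s (p.1 *: p.2) * (b + c) / s p.2) => p0.
  by rewrite /U e -scalerDl !scalerA divfK// s0.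
have /choice[t tP] := Uscale.
have tP2 a x : x != 0 -> U (a *: x) = t (a, x) *: U x by move/(tP (a, x)).
have [e eN] := dim3 0 0.
have e0 : e != 0 by apply/eqP => e0; apply: eN; rewrite e0; exact: span2l.
have t_indep a x y : indep2 x y -> t (a, x) = t (a, y).
  move=> i; have xD : x + y != 0.
    by apply: indep2_neq0 (indep2C (indep2D i)).
  have /eqP := tP2 a _ xD; rewrite scalerDr (Uadd (a *: x)) !tP2 ?(indep2_neq0 i)//;
    last exact: indep2_neq0 (indep2C i).
  rewrite Uadd scalerDr -subr_eq0 opprD addrACA -!scalerBl.
  by move=> /eqP/(Ui _ _ i)[/subr0_eq-> /subr0_eq->].
have t_const a x : x != 0 -> t (a, x) = t (a, e).
  move=> x0; have [i|/(not_indep2 e0)[b xE]] := pselect (indep2 e x).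
    exact/esym/t_indep.
  have [z /(nspan_indep2 e0) iez] := dim3 e e.
  have b0 : b != 0 by apply: contra_neq x0 => b0; rewrite xE b0 scale0r.
  rewrite (t_indep a e z)// xE; apply: t_indep; exact: indep2Z.
pose sigma a := t (a, e).
have UZ a x : U (a *: x) = sigma a *: U x.
  have [->|x0] := eqVneq x 0; first by rewrite scaler0 U0 scaler0.
  by rewrite tP2// t_const.
have UeI a b : a *: U e = b *: U e -> a = b.
  by move/eqP; rewrite -subr_eq0 -scalerBl scaler_eq0 (negPf (Uneq0 _ e0)) orbF
    => /eqP/subr0_eq.
have sigmaB : zmod_morphism sigma.
  move=> a b; apply: UeI; rewrite scalerBl -!UZ scalerBl.
  have UN x : U (- x) = - U x.
    by apply/eqP; rewrite -addr_eq0 -Uadd addNr U0.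
  by rewrite Uadd UN.
have sigmaM : monoid_morphism sigma.
  split=> [|a b]; apply: UeI; first by rewrite -UZ !scale1r.
  by rewrite -UZ -!scalerA !UZ.
exists U, (HB.pack sigma (GRing.isZmodMorphism.Build _ _ sigma sigmaB)
  (GRing.isMonoidMorphism.Build _ _ sigma sigmaM) : {rmorphism K -> K}).
split=> // x; have [->|x0] := eqVneq x 0.
  by exists 1; rewrite ?oner_neq0// U0 g0 scaler0.
by exists (s x); rewrite ?s0.
Qed.
End FundamentalTheorem.

(** * Orthogonality with respect to the form of [eta] *)

Section InnerProduct.
Variables (K : numFieldType) (theta : {rmorphism K -> K}).
(** Satisfied by the identity on the reals and by the conjugation on the complex numbers, so that
    both cases are treated together. *)
Hypothesis theta_norm : forall a, a * theta a = `|a| ^+ 2.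
Variables (H : completeNormedModType K) (dot : {dot H for theta}).
Implicit Types x y z w : H.

Lemma dotC x y : dot x y = theta (dot y x).
Proof. by rewrite hermC expr0 mul1r. Qed.

Lemma dotZl (a : K) x y : dot (a *: x) y = a * dot x y.
Proof. exact: linearZl_LR. Qed.

Lemma dotZr (a : K) x y : dot x (a *: y) = theta a * dot x y.
Proof. exact: linearZr_LR. Qed.

Lemma dotDl x y z : dot (x + y) z = dot x z + dot y z.
Proof. exact: linearDl. Qed.

Lemma dotBl x y z : dot (x - y) z = dot x z - dot y z.
Proof. exact: linearBl. Qed.

Lemma dotDr x y z : dot x (y + z) = dot x y + dot x z.
Proof. exact: linearDr. Qed.

Lemma dotBr x y z : dot x (y - z) = dot x y - dot x z.
Proof. exact: linearBr. Qed.

Lemma dot0r x : dot x 0 = 0.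
Proof. exact: linear0r. Qed.

Lemma dot0l x : dot 0 x = 0.
Proof. exact: linear0l. Qed.

Lemma dot_eq0C x y : dot x y = 0 -> dot y x = 0.
Proof. by move=> e; rewrite dotC e rmorph0. Qed.

Lemma dot_gt0 x : x != 0 -> 0 < dot x x.
Proof. exact: neq0_dnorm_gt0. Qed.

Lemma dot_eq0 x : dot x x = 0 -> x = 0.
Proof.
by move=> e; apply: contrapT => /eqP/dot_gt0; rewrite e ltxx.
Qed.

Lemma exists_proj1 x y : exists a, dot (x - a *: y) y = 0.
Proof.
have [->|y0] := eqVneq y 0; first by exists 0; rewrite dot0r.
exists (dot x y / dot y y).
by rewrite dotBl dotZl divfK ?subrr// gt_eqF// dot_gt0.
Qed.

(** Gram-Schmidt: [z] is replaced by its component [v] orthogonal to [y], and [x] is projected on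
    [y] and on [v]. *)
Lemma exists_proj2 x y z :
  exists2 u, span2 y z u & dot (x - u) y = 0 /\ dot (x - u) z = 0.
Proof.
have [a za] := exists_proj1 z y; set v := z - a *: y in za.
have [b xb] := exists_proj1 x y; have [c xc] := exists_proj1 x v.
have zE : z = v + a *: y by rewrite subrK.
have vy := za; have yv := dot_eq0C za.
exists (b *: y + c *: v).
  by exists (b - c * a), c; rewrite scalerBl scalerBr scalerA addrA addrAC.
have wy : dot (x - (b *: y + c *: v)) y = 0.
  by rewrite opprD addrA dotBl xb dotZl vy mulr0 subr0.
split=> //; rewrite zE dotDr dotZr wy mulr0 addr0.
by rewrite opprD [- (b *: y) - _]addrC addrA dotBl xc dotZl yv mulr0 subr0.
Qed.

(** The residue of [x] after projection to the span is orthogonal to [y] and [z], hence also to [x]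
    and to the projection, hence to itself. *)
Lemma span2_orth x y z :
  span2 y z x <-> forall w, dot w y = 0 -> dot w z = 0 -> dot w x = 0.
Proof.
split=> [[a [b ->]] w wy wz|h].
  by rewrite dotDr !dotZr wy wz !mulr0 addr0.
have [u uyz [wy wz]] := exists_proj2 x y z.
have wx := h _ wy wz; suff -> : x = u by [].
apply/subr0_eq/dot_eq0; rewrite dotBr wx sub0r.
by move: uyz => [a [b {2}->]]; rewrite dotDr !dotZr wy wz !mulr0 addr0 oppr0.
Qed.

Hypothesis dot_norm : norm_from_dot dot.

Lemma cauchy_schwarz x y : `|dot x y| <= `|x| * `|y|.
Proof.
have [->|y0] := eqVneq y 0; first by rewrite dot0r !normr0 mulr0.
set n := dot y y; set d := dot x y.
have n0 : 0 < n := dot_gt0 y0.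
have tn : theta n = n by rewrite -dotC.
(* This vector is [n] times the component of [x] orthogonal to [y]. *)
have : 0 <= dot (n *: x - d *: y) (n *: x - d *: y).
  by rewrite -dot_norm exprn_ge0.
have -> : dot (n *: x - d *: y) (n *: x - d *: y) = n * (dot x x * n - `|d| ^+ 2).
  rewrite dotBl !dotBr !dotZl !dotZr tn -/n -/d (dotC y x) -/d.
  by rewrite -theta_norm; ring.
rewrite pmulr_rge0// subr_ge0 /n -!dot_norm -exprMn.
by rewrite ler_pXn2r ?nnegrE ?mulr_ge0.
Qed.

Variable eta : {linear H -> H}.
Hypothesis eta_surj : forall y, exists x, eta x = y.
Local Notation B := (eta_form dot eta).

Lemma etaDl x y z : B (x + y) z = B x z + B y z.
Proof. by rewrite /eta_form linearD dotDl. Qed.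

Lemma etaDr x y z : B x (y + z) = B x y + B x z.
Proof. by rewrite /eta_form dotDr. Qed.

Lemma etaZl a x y : B (a *: x) y = a * B x y.
Proof. by rewrite /eta_form linearZ dotZl. Qed.

Lemma etaZr a x y : B x (a *: y) = theta a * B x y.
Proof. exact: dotZr. Qed.

Lemma eta0r x : B x 0 = 0.
Proof. by rewrite /eta_form dot0r. Qed.

Lemma eta0l x : B 0 x = 0.
Proof. by rewrite /eta_form linear0 dot0l. Qed.

Lemma eta_nondegenerate y : (forall x, B x y = 0) -> y = 0.
Proof. by have [x xy] := eta_surj y => /(_ x); rewrite /eta_form xy => /dot_eq0. Qed.

Lemma eta_dual y : y != 0 -> exists x, B x y = 1.
Proof.
move=> y0; have [x xy] := eta_surj y; exists ((dot y y)^-1 *: x).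
by rewrite etaZl /eta_form xy mulVf// gt_eqF// dot_gt0.
Qed.

Lemma span2_eta x y z :
  span2 y z x <-> forall w, B w y = 0 -> B w z = 0 -> B w x = 0.
Proof.
rewrite span2_orth; split=> h w; first exact: h.
by have [u <-] := eta_surj w; exact: h.
Qed.

Lemma eta_dual2 y z : indep2 y z -> exists2 x, B x y = 1 & B x z = 0.
Proof.
move=> i; have /span2_eta/existsNP[w] := indep2_span (indep2C i).
move=> /not_implyP[wz /not_implyP[_ /eqP wy]].
exists ((B w y)^-1 *: w); first by rewrite etaZl mulVf.
by rewrite etaZl wz mulr0.
Qed.

Hypothesis dim3 : dim_ge 3 H.

(** With [B x0 y = 1], the vector [x - B x y *: x0] is orthogonal to [y], which yields a constant
    [c y] for each [y]. A vector [x] with [B x y = 1] and [B x z = 0] shows [c y = c (y + z)] for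
    independent [y] and [z]. *)
Lemma orthogonality_multiple (sigma : {rmorphism K -> K}) (U : H -> H) :
    {morph U : x y / x + y} -> (forall a x, U (a *: x) = sigma a *: U x) ->
    (forall x y, B x y = 0 -> B (U x) (U y) = 0) ->
  exists c, forall x y, B (U x) (U y) = c * sigma (B x y).
Proof.
move=> UD UZ U_orth.
have U0 : U 0 = 0 by have := UZ 0 0; rewrite rmorph0 !scale0r.
have /choice[c cP] : forall y, exists c, forall x, B (U x) (U y) = c * sigma (B x y).
  move=> y; have [->|y0] := eqVneq y 0.
    by exists 0 => x; rewrite U0 eta0r mul0r.
  have [x0 x0y] := eta_dual y0; exists (B (U x0) (U y)) => x.
  have /U_orth : B (x - B x y *: x0) y = 0.
    by rewrite -scaleNr etaDl etaZl x0y mulr1 subrr.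
  rewrite -scaleNr UD UZ etaDl etaZl rmorphN mulNr => /subr0_eq ->.
  by rewrite mulrC.
have c_indep y z : indep2 y z -> c y = c (y + z).
  move=> i; have [x xy xz] := eta_dual2 i.
  have := cP (y + z) x; rewrite UD !etaDr !cP xy xz addr0 rmorph1 rmorph0.
  by rewrite mulr0 !mulr1 addr0.
have c_indep2 y z : indep2 y z -> c y = c z.
  by move=> i; rewrite (c_indep y z)// addrC (c_indep z y)//; exact: indep2C.
have [e eN] := dim_ge3_span2 0 0 dim3.
have e0 : e != 0 by apply/eqP => e0; apply: eN; rewrite e0; exact: span2l.
exists (c e) => x y; have [->|y0] := eqVneq y 0.
  by rewrite U0 !eta0r rmorph0 mulr0.
rewrite cP; congr (_ * _); have [i|/(not_indep2 e0)[a yE]] := pselect (indep2 e y).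
  exact/esym/c_indep2.
have [z /(nspan_indep2 e0) iez] := dim_ge3_span2 e e dim3.
have a0 : a != 0 by apply: contra_neq y0 => a0; rewrite yE a0 scale0r.
by rewrite (c_indep2 e z)// yE; apply: c_indep2; exact: indep2Z.
Qed.

Lemma multiple_commute (c : K) (sigma : {rmorphism K -> K}) (U : H -> H) :
    (forall a x, U (a *: x) = sigma a *: U x) -> c != 0 ->
    (forall x y, B (U x) (U y) = c * sigma (B x y)) ->
  forall a, sigma (theta a) = theta (sigma a).
Proof.
move=> UZ c0 UB a; have [e eN] := dim_ge3_span2 0 0 dim3.
have e0 : e != 0 by apply/eqP => e0; apply: eN; rewrite e0; exact: span2l.
have [x xe] := eta_dual e0; have := UB x (a *: e).
rewrite UZ !etaZr UB xe mulr1 rmorph1 mulr1 mulrC => /(mulfI c0) ->.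
by [].
Qed.
End InnerProduct.

(** * Uniform boundedness *)

Section Completeness.
Variable K : numFieldType.
Hypothesis arch : forall a : K, 0 <= a -> exists n : nat, a < n%:R.

Lemma geometric_lt (a b : K) : 0 <= a -> 0 < b -> exists n, a * 8^-1 ^+ n < b.
Proof.
move=> a0 b0; have [n an] := arch (divr_ge0 a0 (ltW b0)).
exists n; rewrite exprVn ltr_pdivrMr ?exprn_gt0//.
rewrite mulrC -ltr_pdivrMr//; apply: lt_le_trans an _.
by rewrite -natrX ler_nat ltnW// ltn_expl.
Qed.

Lemma geometric_eq0 (V : normedZmodType K) (v : V) (a : K) : 0 <= a ->
  (forall n, `|v| <= a * 8^-1 ^+ n) -> v = 0.
Proof.
move=> a0 va; apply/eqP/contraT; rewrite -normr_gt0 => v0.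
have [n] := geometric_lt a0 v0.
by move=> /(le_lt_trans (va n)); rewrite ltxx.
Qed.

Lemma geometric_limit (H : completeNormedModType K) (x : nat -> H) :
    (forall n, `|x n.+1 - x n| <= 8^-1 ^+ n) ->
  exists l, forall n, `|l - x n| <= 2 * 8^-1 ^+ n.
Proof.
move=> xS; pose b n : K := 8^-1 ^+ n.
have b_gt0 n : 0 < b n by rewrite exprn_gt0 ?invr_gt0.
(* The subtracted term lets the induction close: [3 / 2 * (1 - 1 / 8)] exceeds 1 by [5 / 16]. *)
have xD n k : `|x (n + k)%N - x n| <= 3 / 2 * (b n - b (n + k)%N).
  elim: k => [|k IHk]; first by rewrite addn0 !subrr normr0 mulr0.
  rewrite addnS; apply: le_trans (ler_distD (x (n + k)%N) _ _) _.
  apply: le_trans (lerD (xS _) IHk) _.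
  rewrite -/(b (n + k)%N) [b (n + k).+1]exprS -/(b _) -subr_ge0.
  rewrite [leRHS](_ : _ = 5 / 16 * b (n + k)%N); last by field.
  by rewrite mulr_ge0 ?divr_ge0 ?ltW.
have xD' n k : `|x (n + k)%N - x n| <= 3 / 2 * b n.
  by apply: le_trans (xD n k) _; rewrite ler_pM2l ?divr_gt0// gerBl ltW.
have : cvg (x @ \oo).
  apply: cauchy_cvg; apply: cauchy_exP => e e0.
  have [n ne] := geometric_lt (divr_ge0 (ler0n K 3) (ler0n K 2)) e0.
  exists (x n), n => // m /= nm; rewrite -ball_normE /= distrC.
  by rewrite -(subnKC nm); apply: le_lt_trans (xD' _ _) _.
move=> /cvg_ex[/= l xl]; exists l => n.
have : \forall m \near \oo, `|l - x m| < 2^-1 * b n.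
  by move/cvgrPdist_lt: xl; apply; rewrite mulr_gt0 ?invr_gt0 ?b_gt0.
case=> N _ /(_ (n + N)%N (leq_addl _ _)) /= /ltW lxm.
apply: le_trans (ler_distD (x (n + N)%N) _ _) _.
apply: le_trans (lerD lxm (xD' _ _)) _.
by rewrite -mulrDl (_ : _ + _ = 2)//; field.
Qed.
End Completeness.

(** * Weakly bounded sets are bounded *)

Section WeaklyBounded.
Variables (K : numFieldType) (theta : {rmorphism K -> K}).
Hypothesis arch : forall a : K, 0 <= a -> exists n : nat, a < n%:R.
Hypothesis theta_norm : forall a, a * theta a = `|a| ^+ 2.
Variables (H : completeNormedModType K) (dot : {dot H for theta}).
Hypothesis dot_norm : norm_from_dot dot.

(* Gliding hump: along a sequence in [S] of rapidly growing norm one builds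
   [x n] with [x n.+1] moved by [8^-n] towards the n-th vector whenever that is
   needed to make their inner product large; the limit contradicts weak
   boundedness. *)
Lemma weakly_bounded (S : set H) :
    (forall w, exists C, forall v, S v -> `|dot v w| <= C) ->
  exists M, forall v, S v -> `|v| <= M.
Proof.
move=> wb; apply: contrapT => /forallNP unb.
(* The growth is chosen so that the final lower bound [|v n| / (4 * 8 ^ n)] is at least [n]. *)
have /choice[v vP] : forall n : nat, exists v, S v /\ (n * 4 * 8 ^ n)%:R < `|v|.
  move=> n; have /existsNP[v /not_implyP[Sv /negP]] := unb (n * 4 * 8 ^ n)%:R.
  by rewrite -real_ltNge// => nv; exists v.
have v0 n : 0 < `|v n| by apply: le_lt_trans (vP n).2.
pose d n : H := (8^-1 ^+ n / `|v n|) *: v n.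
have dn n : `|d n| = 8^-1 ^+ n.
  rewrite normrZ normrM normfV normr_id divfK ?gt_eqF//.
  by rewrite ger0_norm// exprn_ge0 ?invr_ge0.
have dd n : dot (v n) (d n) = 8^-1 ^+ n * `|v n|.
  have realE (a : K) : 0 <= a -> theta a = a.
    move=> a0; have [->|an0] := eqVneq a 0; first by rewrite rmorph0.
    by apply: (mulfI an0); rewrite theta_norm ger0_norm// expr2.
  rewrite dotZr -dot_norm realE ?divr_ge0 ?exprn_ge0 ?invr_ge0//.
  by rewrite expr2 mulrA divfK// gt_eqF.
(* Adding [d n] changes the inner product by [a = 8^-1 ^+ n * |v n|], so it has modulus at least
   [a / 2] either before or after. *)
have step (p : nat * H) : exists y, `|y - p.2| <= 8^-1 ^+ p.1 /\
    2^-1 * (8^-1 ^+ p.1 * `|v p.1|) <= `|dot (v p.1) y|.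
  move: p => [n x] /=; have [h|h] := boolP
      (2^-1 * (8^-1 ^+ n * `|v n|) <= `|dot (v n) x|).
    by exists x; split=> //; rewrite subrr normr0 exprn_ge0 ?invr_ge0.
  exists (x + d n); rewrite addrAC subrr add0r dn; split=> //.
  rewrite dotDr dd; set a := 8^-1 ^+ n * `|v n| in h *.
  have a0 : 0 <= a by rewrite mulr_ge0 ?exprn_ge0 ?invr_ge0.
  rewrite -real_ltNge ?normr_real ?ger0_real ?mulr_ge0 ?invr_ge0 ?exprn_ge0 ?invr_ge0// in h.
  have := ler_normB (dot (v n) x + a) (dot (v n) x).
  rewrite addrAC subrr add0r (ger0_norm a0) => h2.
  rewrite -(lerD2r `|dot (v n) x|); apply: le_trans h2.
  apply: le_trans (lerD (lexx _) (ltW h)) _.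
  by rewrite (_ : _ + _ = a)//; field.
have /choice[f fP] := step.
pose x := fix x n := if n is m.+1 then f (m, x m) else 0 : H.
have [l lx] := geometric_limit arch (fun n => (fP (n, x n)).1 : `|x n.+1 - x n| <= _).
have [C Cl] := wb l.
have C0 : 0 <= C := le_trans (normr_ge0 _) (Cl _ (vP 0).1).
have [n Cn] := arch C0.
have := le_lt_trans (Cl _ (vP n).1) Cn; apply/negP.
rewrite -real_leNgt ?normr_real ?realn//.
have := lerB_dist (dot (v n) (x n.+1)) (dot (v n) (x n.+1) - dot (v n) l).
rewrite subKr; apply: le_trans; rewrite -dotBr.
apply: le_trans (lerB (fP (n, x n)).2 (cauchy_schwarz theta_norm dot_norm _ _)).
apply: le_trans (lerB (lexx _) (ler_wpM2l (ltW (v0 n)) _)); last first.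
  by rewrite distrC; exact: lx.
(* The hump contributes [1 / 2] and the tail takes away at most [2 / 8], both in units of
   [8^-1 ^+ n * |v n|]. *)
rewrite exprS /= (_ : _ - _ = `|v n| / (4 * 8 ^+ n)); last first.
  by rewrite exprVn; field; rewrite expf_neq0 ?pnatr_eq0.
rewrite ler_pdivlMr ?mulr_gt0 ?exprn_gt0//; apply: le_trans (ltW (vP n).2).
by rewrite !natrM natrX mulrA.
Qed.
End WeaklyBounded.

(** * The Riesz representation theorem *)

Section Riesz.
Variables (K : numFieldType) (theta : {rmorphism K -> K}).
Hypothesis arch : forall a : K, 0 <= a -> exists n : nat, a < n%:R.
Hypothesis theta_norm : forall a, a * theta a = `|a| ^+ 2.
Variables (H : completeNormedModType K) (dot : {dot H for theta}).
Hypothesis dot_norm : norm_from_dot dot.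
Hypothesis has_infimum : forall P : K -> Prop,
  (exists a, P a) -> (forall a, P a -> 0 <= a) ->
  exists m, (forall a, P a -> m <= a) /\
    forall e, 0 < e -> exists2 a, P a & a < m + e.

(** The midpoint form suits minimizing sequences: a hyperplane [f = 1] contains the midpoint of any
    two of its points, which bounds the last norm from below. *)
Lemma parallelogram (x y : H) :
  `|x - y| ^+ 2 = 2 * `|x| ^+ 2 + 2 * `|y| ^+ 2 - 4 * `|2^-1 *: (x + y)| ^+ 2.
Proof.
rewrite normrZ exprMn ger0_norm ?invr_ge0// !dot_norm.
by rewrite !(dotBl, dotBr, dotDl, dotDr); field.
Qed.

(** A nonzero vector forces [0 <= M]; in the zero space the bound 0 serves. *)
Lemma bounded_op_ge0 (V : normedModType K) (U : H -> V) :
  (exists M, forall x, `|U x| <= M * `|x|) ->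
  exists2 M, 0 <= M & forall x, `|U x| <= M * `|x|.
Proof.
move=> [M UM]; have [[x x0]|H0] := pselect (exists x : H, x != 0).
  exists M => //; rewrite -(@pmulr_lge0 _ `|x|) ?normr_gt0//.
  exact: le_trans (UM x).
exists 0 => // x; apply: le_trans (UM x) _; have [->|x0] := eqVneq x 0.
  by rewrite normr0 !mulr0.
by case: H0; exists x.
Qed.

(* [f] is represented by a multiple of the vector of least norm in the
   hyperplane [f = 1]. *)
Theorem riesz (f : {linear H -> K^o}) :
  (exists M, forall x, `|f x : K| <= M * `|x|) ->
  exists z, forall x, f x = dot x z.
Proof.
move=> /(@bounded_op_ge0 K^o)[M M0 fM].
have [f0|/existsNP[x1 /eqP fx1]] := pselect (forall x, f x = 0).
  by exists 0 => x; rewrite f0 dot0r.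
have [||m [m_le m_inf]] := @has_infimum (fun a => exists2 x, f x = 1 & a = `|x| ^+ 2).
- exists (`|(f x1)^-1 *: x1| ^+ 2), ((f x1)^-1 *: x1) => //.
  by rewrite linearZ; exact: mulVf.
- by move=> a [x _ ->]; rewrite exprn_ge0.
pose b n : K := 8^-1 ^+ n.
have b_gt0 n : 0 < b n by rewrite exprn_gt0 ?invr_gt0.
have b_ge0 n : 0 <= b n by exact: ltW.
(* With tolerance [4^-1 * b n ^+ 2] the parallelogram law bounds consecutive squared distances by
   [65 / 128 * b n ^+ 2]. *)
have /choice[x xP] : forall n, exists x, f x = 1 /\ `|x| ^+ 2 < m + 4^-1 * b n ^+ 2.
  move=> n; have [|a [x fx ->] xa] := m_inf (4^-1 * b n ^+ 2).
    by rewrite mulr_gt0 ?invr_gt0 // exprn_gt0.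
  by exists x.
have xS n : `|x n.+1 - x n| <= b n.
  rewrite -(@ler_pXn2r _ 2) ?nnegrE// parallelogram.
  have fmid : f (2^-1 *: (x n.+1 + x n)) = 1.
    rewrite linearZ linearD (xP n.+1).1 (xP n).1; apply: (@mulVf K 2).
    by rewrite pnatr_eq0.
  have mid : m <= `|2^-1 *: (x n.+1 + x n)| ^+ 2.
    by apply: m_le; exists (2^-1 *: (x n.+1 + x n)).
  apply: (@le_trans _ _ (2 * (m + 4^-1 * b n.+1 ^+ 2) +
      2 * (m + 4^-1 * b n ^+ 2) - 4 * m)).
    by apply: lerB; rewrite ?ler_pM2l//; apply: lerD; rewrite ler_pM2l// ltW// (xP _).2.
  rewrite (_ : b n.+1 = 8^-1 * b n) ?/b ?exprS// -/(b n) -subr_ge0.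
  rewrite [leRHS](_ : _ = 63 / 128 * b n ^+ 2); last by field.
  by apply: mulr_ge0; [exact: divr_ge0 | exact/exprn_ge0/b_ge0].
have [l lx] := geometric_limit arch xS.
have fl : f l = 1.
  apply/subr0_eq/(@geometric_eq0 _ arch K (f l - 1) (M * 2)) => [|n].
    by rewrite mulr_ge0.
  rewrite -[X in _ - X](xP n).1 -linearB; apply: le_trans (fM _) _.
  by rewrite -mulrA ler_wpM2l.
(* Removing from [x n] its component along [h] stays in the hyperplane [f = 1], so by
   near-minimality that component is small; then pass to the limit [l]. *)
have ortho_ker h : f h = 0 -> dot l h = 0.
  move=> fh; have [->|h0] := eqVneq h 0; first by rewrite dot0r.
  have xh n : `|dot (x n) h| <= b n * `|h|.
    set d := dot (x n) h; pose y := x n - (d / dot h h) *: h.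
    have hh0 : dot h h != 0 by rewrite gt_eqF// dot_gt0.
    have yh : dot y h = 0 by rewrite dotBl dotZl divfK ?subrr.
    have yy : `|y| ^+ 2 = `|x n| ^+ 2 - `|d| ^+ 2 / `|h| ^+ 2.
      rewrite !dot_norm {2}/y dotBr dotZr yh mulr0 subr0 dotBl dotZl.
      by rewrite (dotC dot h (x n)) -/d -theta_norm mulrAC.
    have : m <= `|y| ^+ 2.
      apply: m_le; exists y => //.
      by rewrite linearB linearZ (xP n).1 fh /= [_ *: _]mulr0 subr0.
    rewrite yy lerBrDr => /le_lt_trans/(_ (xP n).2).
    rewrite ltrD2l ltr_pdivrMr ?exprn_gt0 ?normr_gt0// => dh.
    rewrite -(@ler_pXn2r _ 2) ?nnegrE ?mulr_ge0 ?b_ge0// exprMn.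
    apply: le_trans (ltW dh) _; rewrite ler_wpM2r ?exprn_ge0//.
    apply: ler_piMl; first exact/exprn_ge0/b_ge0.
    by rewrite -[leRHS]invr1 lef_pV2 ?posrE ?ler1n.
  apply: (@geometric_eq0 _ arch K^o _ (3 * `|h|)) => [|n]; first by rewrite mulr_ge0.
  have -> : dot l h = dot (l - x n) h + dot (x n) h by rewrite dotBl subrK.
  apply: le_trans (ler_normD _ _) _.
  apply: le_trans (lerD (cauchy_schwarz theta_norm dot_norm _ _) (xh n)) _.
  apply: le_trans (lerD (ler_wpM2r (normr_ge0 h) (lx n)) (lexx _)) _.
  by rewrite -/(b n) (_ : _ + _ = 3 * `|h| * b n)//; ring.
have l0 : l != 0.
  by apply/eqP => l0; move: fl; rewrite l0 linear0 => /esym/eqP; rewrite oner_eq0.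
exists ((dot l l)^-1 *: l) => y; rewrite dotZr fmorphV -dotC.
have : f (y - f y *: l) = 0.
  by rewrite linearB linearZ fl /= [_ *: _]mulr1 subrr.
move=> /ortho_ker/dot_eq0C; rewrite dotBl dotZl => /subr0_eq ->.
by rewrite mulrC mulfK// gt_eqF// dot_gt0.
Qed.

(** Cauchy-Schwarz makes [x |-> dot (A x) y] a bounded functional, so Riesz rules out the default
    value of [xget]. *)
Lemma adjointP (A : {linear H -> H}) : bounded_op A ->
  forall x y, dot (A x) y = dot x (adjoint dot A y).
Proof.
move=> bA x y; rewrite /adjoint; case: xgetP => [z -> //|noz]; exfalso.
pose f x : K^o := dot (A x) y.
have f_lin : linear f by move=> a u v; rewrite /f linearP dotDl dotZl.
pose F : {linear H -> K^o} := HB.pack f (GRing.isLinear.Build _ _ _ _ f f_lin).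
have [|z zP] := @riesz F; last by case: (noz z).
have [M M0 AM] := bounded_op_ge0 bA.
exists (M * `|y|) => u; apply: le_trans (cauchy_schwarz theta_norm dot_norm _ _) _.
by rewrite mulrAC ler_wpM2r.
Qed.
End Riesz.

(** * Transformations of rays *)

(** Unfolds to [linear] for the identity and to [conj_linear] for [Num.conj], giving one notion for
    both kinds of operators. *)
Definition semilinear (K : numFieldType) (H : lmodType K) (sigma : K -> K)
  (U : H -> H) : Prop := forall a x y, U (a *: x + y) = sigma a *: U x + U y.

Section Semilinear.
Variables (K : numFieldType) (H : lmodType K) (sigma : {rmorphism K -> K}).
Variable U : H -> H.
Hypothesis sU : semilinear sigma U.

Lemma semilinearD : {morph U : x y / x + y}.
Proof. by move=> x y; have := sU 1 x y; rewrite rmorph1 !scale1r. Qed.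

Lemma semilinear0 : U 0 = 0.
Proof. by apply: (@addIr _ (U 0)); rewrite -semilinearD !add0r. Qed.

Lemma semilinearZ a x : U (a *: x) = sigma a *: U x.
Proof. by have := sU a x 0; rewrite semilinear0 !addr0. Qed.

Lemma semilinear_inj0 : (forall x, U x = 0 -> x = 0) -> injective U.
Proof.
move=> U0 x y Uxy; apply/subr0_eq/U0.
by rewrite addrC -scaleN1r sU rmorphN1 Uxy scaleN1r addNr.
Qed.
End Semilinear.

Section Rays.
Variables (K : numFieldType) (H : lmodType K).
Implicit Types (x y : H) (r s : rays H).

Lemma ray_self x : ray x x.
Proof. by exists 1; rewrite ?oner_neq0// scale1r. Qed.

Lemma ray_eqP x y : ray_of x = ray_of y <-> ray x y.
Proof.
split=> [e|[c c0 ->]].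
  by have -> : ray x = ray y := congr1 sval e; exact: ray_self.
apply: eq_exist; apply/seteqP; split=> z /= [a a0 ->].
  by exists (a / c); rewrite ?mulf_neq0 ?invr_eq0// scalerA divfK.
by exists (a * c); rewrite ?mulf_neq0// scalerA.
Qed.

Lemma ray_repr r : exists x, r = ray_of x.
Proof. by case: r => r [x rx]; exists x; apply: eq_exist. Qed.
End Rays.

Section Symmetries.
Variables (K : numFieldType) (theta : {rmorphism K -> K}).
Hypothesis arch : forall a : K, 0 <= a -> exists n : nat, a < n%:R.
Hypothesis theta_norm : forall a, a * theta a = `|a| ^+ 2.
Variables (H : completeNormedModType K) (dot : {dot H for theta}).
Hypothesis dot_norm : norm_from_dot dot.
Hypothesis dim3 : dim_ge 3 H.
Variable eta : {linear H -> H}.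
Hypothesis eta_inv : invertible_bounded eta.
Local Notation B := (eta_form dot eta).

Lemma eta_surj y : exists x, eta x = y.
Proof. by have [_ [E [_ _ eE]]] := eta_inv; exists (E y). Qed.

Lemma ray_orth_ray_of x y :
  ray_orth dot eta (ray_of x) (ray_of y) <-> B x y = 0.
Proof.
split=> [|e x0 y0 [a _ ->] [b _ ->]]; first by apply; exact: ray_self.
by rewrite etaZl etaZr e !mulr0.
Qed.

Lemma exists_dual_pair : exists x y, B x y = 1.
Proof.
have [e eN] := dim_ge3_span2 0 0 dim3.
have e0 : e != 0 by apply/eqP => e0; apply: eN; rewrite e0; exact: span2l.
by have [x xe] := eta_dual dot eta_surj e0; exists x, e.
Qed.

(** Writing a test vector as [w = U (V w)] bounds its products with the vectors [eta (U x)] divided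
    by [|x|]. The lemma serves for the inducing map and for its inverse. *)
Lemma bounded_of_norm_multiple (U V : H -> H) (k : K) : 0 <= k ->
    (forall x y, `|B (U x) (U y)| = k * `|B x y|) -> cancel V U ->
  bounded_op U.
Proof.
move=> k0 UB VU.
have [[M' M'P] [E [E'P Ee _]]] := eta_inv.
have [M M0 MP] := bounded_op_ge0 (ex_intro _ M' M'P).
have [N' N'P] := E'P; have [N N0 NP] := bounded_op_ge0 (ex_intro _ N' N'P).
have U0 : U 0 = 0.
  rewrite -[LHS]Ee (_ : eta (U 0) = 0); last first.
    apply: (dot_eq0 (dot := dot)); have := UB 0 (V (eta (U 0))).
    rewrite VU eta0l normr0 mulr0; exact: normr0_eq0.
  by apply/eqP; rewrite -normr_le0; have := NP 0; rewrite normr0 mulr0.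
have [w|C CP] := weakly_bounded arch theta_norm dot_norm
    (S := [set v | exists2 x, x != 0 & v = `|x|^-1 *: eta (U x)]).
  exists (k * (M * `|V w|)) => _ [x x0 ->].
  rewrite dotZl normrM normfV normr_id ler_pdivrMl ?normr_gt0//.
  have := UB x (V w); rewrite VU /eta_form => ->; rewrite mulrCA ler_wpM2l//.
  apply: le_trans (cauchy_schwarz theta_norm dot_norm _ _) _.
  by rewrite mulrA ler_wpM2r// mulrC.
exists (N * C) => x; have [->|x0] := eqVneq x 0; first by rewrite U0 normr0 mulr0.
rewrite -[U x]Ee; apply: le_trans (NP _) _; rewrite -mulrA ler_wpM2l//.
have /CP : [set v | exists2 x, x != 0 & v = `|x|^-1 *: eta (U x)] (`|x|^-1 *: eta (U x)).
  by exists x.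
by rewrite normrZ normfV normr_id ler_pdivrMl ?normr_gt0// mulrC.
Qed.

Hypothesis sigma_cases : forall sigma : {rmorphism K -> K},
  (forall a, sigma (theta a) = theta (sigma a)) ->
  sigma =1 id \/ sigma =1 theta.
Hypothesis thetaK : involutive theta.

Lemma norm_theta a : `|theta a| = `|a|.
Proof.
apply/eqP; rewrite -(@eqrXn2 _ 2)// -!theta_norm.
by rewrite thetaK mulrC.
Qed.

Theorem symmetry_induced (T : rays H -> rays H) :
    bijective T -> symmetry_transformation dot eta T ->
  exists U : H -> H,
    [/\ semilinear id U \/ semilinear theta U, invertible_bounded U
      & induced_by T U].
Proof.
move=> Tbij Tsym.
have /choice[g gP] : forall x, exists y, T (ray_of x) = ray_of y.
  by move=> x; exact: ray_repr.
have g_orth x y : B (g x) (g y) = 0 <-> B x y = 0.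
  by rewrite -!ray_orth_ray_of -!gP; exact: Tsym.
have g_surj w : exists x, ray w (g x).
  have [T' _ T'K] := Tbij; have [x xE] := ray_repr (T' (ray_of w)).
  by exists x; apply/ray_eqP; rewrite -gP -xE T'K.
(* The degenerate ray is orthogonal to all rays and [T] is onto, so [g 0] is orthogonal to every
   vector. *)
have g0 : g 0 = 0.
  apply: (eta_nondegenerate (dot := dot) eta_surj) => w.
  have [x [c c0 gx]] := g_surj w; have := (g_orth x 0).2 (eta0r dot eta x).
  by rewrite gx etaZl => /eqP; rewrite mulf_eq0 (negPf c0) => /eqP.
have g_span x y z : span2 (g y) (g z) (g x) <-> span2 y z x.
  rewrite !(span2_eta dot eta_surj); split=> h w; last first.
    (* An arbitrary test vector [w] is, up to a nonzero scalar, some [g u]. *)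
    have [u [c c0 gu]] := g_surj w.
    have wE v : B w (g v) = 0 <-> B u v = 0.
      rewrite -(g_orth u v) gu etaZl; split=> [->|/eqP]; first by rewrite mulr0.
      by rewrite mulf_eq0 (negPf c0) => /eqP.
    by rewrite !wE; exact: h.
  by move=> /g_orth wy /g_orth wz; apply/g_orth/h.
have [U [sigma [UD UZ Ug]]] :=
  fundamental_theorem (fun y z => dim_ge3_span2 y z dim3) g0 g_span.
have U_orth x y : B (U x) (U y) = 0 <-> B x y = 0.
  have [c c0 ->] := Ug x; have [d d0 ->] := Ug y.
  rewrite -(g_orth x y) etaZl etaZr; split=> [/eqP|->]; last by rewrite !mulr0.
  by rewrite !mulf_eq0 fmorph_eq0 (negPf c0) (negPf d0) => /eqP.
have [c UB] := orthogonality_multiple eta_surj dim3 UD UZ (fun x y => (U_orth x y).2).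
have c0 : c != 0.
  have [x [y xy]] := exists_dual_pair; apply/eqP => c0.
  have /U_orth : B (U x) (U y) = 0 by rewrite UB c0 mul0r.
  by rewrite xy => /eqP; rewrite oner_eq0.
have sigmaE := sigma_cases (multiple_commute eta_surj dim3 UZ c0 UB).
have sU : semilinear sigma U by move=> a x y; rewrite UD UZ.
have sigma_surj a : exists b, sigma b = a.
  by have [sE|sE] := sigmaE; [exists a | exists (theta a)]; rewrite sE ?thetaK.
have sigma_norm a : `|sigma a| = `|a|.
  by have [->|->] := sigmaE; rewrite ?norm_theta.
have U_inj : injective U.
  apply: (semilinear_inj0 sU) => x Ux.
  apply: (eta_nondegenerate (dot := dot) eta_surj) => w.
  by apply/U_orth; rewrite Ux eta0r.
have U_surj w : exists x, U x = w.
  have [x [a a0 gx]] := g_surj w; have [b b0 Ux] := Ug x.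
  (* [U x] is [b * a] times [w], and [s] is chosen so that [sigma s] cancels this factor. *)
  have [s sE] := sigma_surj (b * a)^-1.
  exists (s *: x); rewrite UZ sE Ux gx !scalerA -mulrA mulVf ?scale1r//.
  by rewrite mulf_neq0.
have /choice[V VU] := U_surj.
have UV : cancel U V by move=> x; apply: U_inj; rewrite VU.
have UBn x y : `|B (U x) (U y)| = `|c| * `|B x y|.
  by rewrite UB normrM sigma_norm.
exists U; split.
- by have [sE|sE] := sigmaE; [left|right] => a x y; rewrite sU sE.
- split; first exact: bounded_of_norm_multiple UBn VU.
  exists V; split=> //; apply: bounded_of_norm_multiple (_ : 0 <= `|c|^-1) _ UV.
    by rewrite invr_ge0.
  by move=> x y; rewrite -{2}[x]VU -{2}[y]VU UBn mulKf// normr_eq0.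
- move=> x x0; rewrite gP; apply/ray_eqP.
  by have [b b0 ->] := Ug x; exists b.
Qed.

(** On each ray [V] is a multiple [k x] of [U]; additivity of both maps at [x + y] equates [k x] and
    [k y] for independent vectors. Since [sigma] and [tau] may differ, a linear and a
    conjugate-linear map can be compared. *)
Lemma induced_unique (T : rays H -> rays H) (sigma tau : {rmorphism K -> K})
    (U V : H -> H) :
    semilinear sigma U -> semilinear tau V -> bijective U ->
    (forall a, exists b, sigma b = a) ->
    induced_by T U -> induced_by T V ->
  exists c, forall x, V x = c *: U x.
Proof.
move=> sU sV Ubij s_surj TU TV.
have U_inj : injective U := bij_inj Ubij.
have U0 x : x != 0 -> U x != 0.
  by apply: contra_neq => Ux; apply: U_inj; rewrite Ux (semilinear0 sU).
have /choice[k kP] x : exists k, x != 0 -> V x = k *: U x.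
  have [->|x0] := eqVneq x 0; first by exists 0.
  have : ray_of (U x) = ray_of (V x) by rewrite -TU// TV.
  by move=> /ray_eqP[k _ ->]; exists k.
have Ui x y : indep2 x y -> indep2 (U x) (U y).
  move=> i a b; have [a' <-] := s_surj a; have [b' <-] := s_surj b.
  rewrite -!(semilinearZ sU) -(semilinearD sU) -{1}(semilinear0 sU).
  by move=> /U_inj/i[-> ->]; rewrite !rmorph0.
have k_indep x y : indep2 x y -> k x = k y.
  move=> i; have x0 := indep2_neq0 i; have y0 := indep2_neq0 (indep2C i).
  have xy0 : x + y != 0 := indep2_neq0 (indep2C (indep2D i)).
  have /eqP := kP _ xy0; rewrite (semilinearD sU) (semilinearD sV) !kP// scalerDr.
  rewrite -subr_eq0 opprD addrACA -!scalerBl.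
  by move=> /eqP/(Ui _ _ i)[/subr0_eq-> /subr0_eq->].
have [e eN] := dim_ge3_span2 0 0 dim3.
have e0 : e != 0 by apply/eqP => e0; apply: eN; rewrite e0; exact: span2l.
exists (k e) => x; have [->|x0] := eqVneq x 0.
  by rewrite (semilinear0 sU) (semilinear0 sV) scaler0.
rewrite kP//; congr (_ *: _).
have [i|/(not_indep2 e0)[a xE]] := pselect (indep2 e x); first exact/esym/k_indep.
have [z /(nspan_indep2 e0) iez] := dim_ge3_span2 e e dim3.
have a0 : a != 0 by apply: contra_neq x0 => a0; rewrite xE a0 scale0r.
by rewrite (k_indep e z)// xE; apply: k_indep; exact: indep2Z.
Qed.

Lemma induces_symmetryP (sigma : {rmorphism K -> K}) (U : H -> H) :
    semilinear sigma U -> bijective U ->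
  induces_symmetry dot eta U <->
  exists c, forall x y, B (U x) (U y) = c * sigma (B x y).
Proof.
move=> sU Ubij; have UZ := semilinearZ sU; have UD := semilinearD sU.
have U0 := semilinear0 sU.
split=> [[T Tsym TU]|[c UB]].
  apply: (orthogonality_multiple eta_surj dim3 UD UZ) => x y.
  have [->|x0] := eqVneq x 0; first by rewrite U0 !eta0l.
  have [->|y0] := eqVneq y 0; first by rewrite U0 !eta0r.
  by rewrite -!ray_orth_ray_of -!TU// Tsym.
(* A zero constant is excluded because [U] is onto and the form takes the value 1. *)
have c0 : c != 0.
  have [V UV VU] := Ubij; have [x [y xy]] := exists_dual_pair; apply/eqP => c0.
  have := UB (V x) (V y); rewrite !VU xy c0 mul0r => /eqP.
  by rewrite oner_eq0.
(* The induced [T] is defined through chosen representatives; [TU] shows that the choice does not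
   matter. *)
have /choice[rep repP] := @ray_repr K H.
have TU x : ray_of (U (rep (ray_of x))) = ray_of (U x).
  apply/ray_eqP; have /ray_eqP[a a0 {2}->] := esym (repP (ray_of x)).
  by exists (sigma a); rewrite ?fmorph_eq0// UZ.
exists (fun r => ray_of (U (rep r))); last by move=> x _; exact: TU.
move=> r s; have [x ->] := ray_repr r; have [y ->] := ray_repr s.
rewrite !TU !ray_orth_ray_of UB; split=> [/eqP|->]; last by rewrite rmorph0 mulr0.
by rewrite mulf_eq0 (negPf c0) fmorph_eq0 => /eqP.
Qed.
End Symmetries.

(** * The real and the complex field *)

Section RealAutomorphism.
Variable R : realType.

(** Nonnegative reals are squares, so [sigma] is monotone; it fixes the rationals, which are
    dense. *)
Lemma real_endomorphism (sigma : {rmorphism R -> R}) : sigma =1 id.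
Proof.
have mono x y : x <= y -> sigma x <= sigma y.
  move=> xy; rewrite -subr_ge0 -rmorphB -(sqr_sqrtr (_ : 0 <= y - x)) ?subr_ge0//.
  by rewrite rmorphXn sqr_ge0.
move=> x; apply/eqP; case: ltgtP => // h.
- have [q] := rat_in_itvoo h; rewrite in_itv /= => /andP[xq /ltW/mono].
  by rewrite fmorph_rat leNgt xq.
- have [q] := rat_in_itvoo h; rewrite in_itv /= => /andP[/ltW/mono + qx].
  by rewrite fmorph_rat leNgt qx.
Qed.

Lemma real_arch (a : R) : 0 <= a -> exists n : nat, a < n%:R.
Proof. by move=> _; exists (Num.truncn a).+1; exact: truncnS_gt. Qed.

Lemma real_theta_norm (a : R) : a * idfun a = `|a| ^+ 2.
Proof. by rewrite real_normK ?num_real// expr2. Qed.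
End RealAutomorphism.

Section ComplexAutomorphism.
Variable R : realType.

Lemma complex_ge0E (a : R[i]) : 0 <= a -> a = (complex.Re a)%:C.
Proof. by move=> /ger0_real/RRe_real. Qed.

Lemma complex_arch (a : R[i]) : 0 <= a -> exists n : nat, a < n%:R.
Proof.
move=> /complex_ge0E ->; exists (Num.truncn (complex.Re a)).+1.
by rewrite -(rmorph_nat (real_complex R)) ltcR truncnS_gt.
Qed.

(** Nonnegative elements of [R[i]] are real, so the infimum is taken in [R]. *)
Lemma complex_infimum (P : R[i] -> Prop) :
    (exists a, P a) -> (forall a, P a -> 0 <= a) ->
  exists m, (forall a, P a -> m <= a) /\
    forall e, 0 < e -> exists2 a, P a & a < m + e.
Proof.
move=> [a0 Pa0] P_ge0; pose Q : set R := [set r | P r%:C].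
have PE a : P a -> a = (complex.Re a)%:C by move=> /P_ge0/complex_ge0E.
have Qlb : has_lbound Q by exists 0 => r /P_ge0; rewrite ler0c.
have Qinf : has_inf Q.
  by split=> //; exists (complex.Re a0); rewrite /Q /= -PE.
exists (inf Q)%:C; split=> [a Pa|e e0].
  by rewrite (PE a Pa) lecR; apply: ge_inf => //; rewrite /Q /= -PE.
have eE := complex_ge0E (ltW e0).
have [|r Qr re] := @inf_adherent _ Q (complex.Re e) _ Qinf.
  by move: e0; rewrite eE ltcR.
by exists r%:C => //; rewrite eE -rmorphD ltcR.
Qed.

(** Commuting with the conjugation, [sigma] preserves its fixed points, the reals, where it is the
    identity. It is thus determined by its value at ['i], a square root of -1. *)
Lemma complex_endomorphism (sigma : {rmorphism R[i] -> R[i]}) :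
  (forall a, sigma (Num.conj a) = Num.conj (sigma a)) ->
  sigma =1 id \/ sigma =1 Num.conj.
Proof.
move=> sJ; pose tau (x : R) : R := complex.Re (sigma x%:C).
have tauE x : sigma x%:C = (tau x)%:C.
  rewrite RRe_real// CrealE -sJ; apply/eqP; congr (sigma _).
  by apply/eqP; rewrite -CrealE; apply/complex_realP; exists x.
have tauB : zmod_morphism tau.
  by move=> x y; apply: complexI; rewrite -tauE !rmorphB/= !tauE.
have tauM : monoid_morphism tau.
  split=> [|x y]; apply: complexI; first by rewrite -tauE !rmorph1.
  by rewrite -tauE !rmorphM/= !tauE.
have tau_id := @real_endomorphism R (HB.pack tau
  (GRing.isZmodMorphism.Build _ _ tau tauB)
  (GRing.isMonoidMorphism.Build _ _ tau tauM)).
have sR x : sigma x%:C = x%:C by rewrite tauE [tau x]tau_id.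
have sE a : sigma a = (complex.Re a)%:C + sigma 'i%C * (complex.Im a)%:C.
  by rewrite {1}[a]complexE rmorphD rmorphM/= !sR.
have : sigma 'i%C ^+ 2 = 'i%C ^+ 2 by rewrite -rmorphXn sqr_i rmorphN1.
move=> /eqP; rewrite eqf_sqr => /orP[] /eqP si; [left|right] => a; rewrite sE si.
  by rewrite -complexE.
by rewrite [in RHS](complexE a); case: a => x y /=; simpc.
Qed.
End ComplexAutomorphism.

Lemma invertible_bijective (K : numFieldType) (V : normedModType K) (U : V -> V) :
  invertible_bounded U -> bijective U.
Proof. by case=> _ [W [_ UW WU]]; exists W. Qed.

Theorem corollary2 (R : realType) :
  (forall (H : completeNormedModType R) (dot : {dot H for idfun})
          (eta : {linear H -> H}),
     norm_from_dot dot -> dim_ge 3 H -> invertible_bounded eta ->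
     (forall T : rays H -> rays H,
        bijective T -> symmetry_transformation dot eta T ->
        (exists U : H -> H,
           [/\ linear U, invertible_bounded U & induced_by T U])
        /\
        (forall U V : H -> H,
           linear U -> bijective U -> induced_by T U ->
           linear V -> bijective V -> induced_by T V ->
           exists c : R, forall x : H, V x = c *: U x))
     /\
     (forall U : H -> H, linear U -> invertible_bounded U ->
        (induces_symmetry dot eta U <->
         exists c : R, forall x y : H,
           eta_form dot eta (U x) (U y) = c * eta_form dot eta x y)))
  /\
  (forall (H : completeNormedModType R[i]) (dot : {dot H for Num.conj})
          (eta : {linear H -> H}),
     norm_from_dot dot -> dim_ge 3 H -> invertible_bounded eta ->
     (forall T : rays H -> rays H,
        bijective T -> symmetry_transformation dot eta T ->
        (exists U : H -> H,
           [/\ linear U \/ conj_linear U, invertible_bounded U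
             & induced_by T U])
        /\
        (forall U V : H -> H,
           linear U \/ conj_linear U -> bijective U -> induced_by T U ->
           linear V \/ conj_linear V -> bijective V -> induced_by T V ->
           exists c : R[i], forall x : H, V x = c *: U x))
     /\
     (forall U : H -> H, linear U -> invertible_bounded U ->
        (induces_symmetry dot eta U <->
         exists c : R[i], forall x y : H,
           eta_form dot eta (U x) (U y) = c * eta_form dot eta x y))
     /\
     (forall U : H -> H, conj_linear U -> invertible_bounded U ->
        (induces_symmetry dot eta U <->
         exists d : R[i], forall x y : H,
           eta_form dot eta (U x) (U y)
           = d * eta_form dot (adjoint dot eta) y x))).
Proof.
split=> H dot eta dot_norm dim3 eta_inv.
  have arch := @real_arch R; have tn := @real_theta_norm R.
  split=> [T Tbij Tsym|U U_lin U_inv].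
    split=> [|U V U_lin Ubij TU V_lin _ TV].
      have [|//|U [U_lin Uinv TU]] := symmetry_induced arch tn dot_norm dim3
          eta_inv _ _ Tbij Tsym.
        by move=> sigma _; left; exact: real_endomorphism.
      by exists U; split=> //; case: U_lin.
    by apply: (@induced_unique _ H dim3 T idfun idfun U V) => // a; exists a.
  exact: (induces_symmetryP dot dim3 eta_inv (sigma := idfun) U_lin
    (invertible_bijective U_inv)).
have arch := @complex_arch R; have tn a := esym (@normCK R[i] a).
have conj_surj (a : R[i]) : exists b, Num.conj b = a.
  by exists (Num.conj a); rewrite conjCK.
split; [|split].
- move=> T Tbij Tsym; split.
    exact: (symmetry_induced arch tn dot_norm dim3 eta_inv
      (@complex_endomorphism R) (@conjCK _) Tbij Tsym).
  move=> U V [] sU Ubij TU [] sV _ TV.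
  + by apply: (@induced_unique _ H dim3 T idfun idfun U V) => // a; exists a.
  + by apply: (@induced_unique _ H dim3 T idfun Num.conj U V) => // a; exists a.
  + exact: (@induced_unique _ H dim3 T Num.conj idfun U V).
  + exact: (@induced_unique _ H dim3 T Num.conj Num.conj U V).
- move=> U U_lin U_inv.
  exact: (induces_symmetryP dot dim3 eta_inv (sigma := idfun) U_lin
    (invertible_bijective U_inv)).
- move=> U U_lin U_inv.
  (* The form of the adjoint with swapped arguments is the conjugate of the form of [eta], which is
     what the semilinear criterion produces. *)
  have adjE x y : eta_form dot (adjoint dot eta) y x = Num.conj (eta_form dot eta x y).
    rewrite /eta_form (dotC dot) -(adjointP arch tn dot_norm (@complex_infimum R)) //.
    by case: eta_inv.
  apply: iff_trans (induces_symmetryP dot dim3 eta_inv (sigma := Num.conj) U_lin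
    (invertible_bijective U_inv)) _.
  by split=> [] [c cP]; exists c => x y; rewrite cP adjE.
Qed.
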